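(* Let $\pi_R$ be the right projection of (the canonical relation $C$ of) the weighted cylinder transform $\mathcal{C}$ and let $\Sigma=\{x\cdot\theta=0\}\subset C$. Then the flowout of $\pi_R(\Sigma)$ is $$\Lambda=\{(x,\xi;\mathcal{O}(x,\xi)): x\in B^3_{\alpha_1,\alpha_2},\ \xi\in\mathbb{R}^3\setminus0,\ x\times\xi=0,\ \mathcal{O}\in\Delta(SO_3\times SO_3)\},$$ where $\mathcal{O}(x,\xi)=(Ox,O\xi)$ and $O\in SO_3$ is any rotation.
   Context: Fix $0<\epsilon_1<\epsilon_2<1$ and put $\alpha_i=2\epsilon_i/(1-\epsilon_i^2)$, $i=1,2$. Let $B^3_{a,b}=\{x\in\mathbb{R}^3:a<|x|<b\}$. Define $v(x)=\left(\sqrt{1+\frac{1}{|x|^2}}-\frac{1}{|x|}\right)\frac{x}{|x|}$, a diffeomorphism $B^3_{\alpha_1,\alpha_2}\to B^3_{\epsilon_1,\epsilon_2}$, and, for $y\in B^3_{\epsilon_1,\epsilon_2}$, $\theta\in S^2$, let $h(s,y,\theta)=\frac{4|y\times\theta|^2}{(1-|y|^2)^2}-s$. Write $w(x,\theta)=|(\nabla_y h)(s,v(x),\theta)|$, which does not depend on $s$. The weighted cylinder transform $\mathcal{C}:C_0^\infty(B^3_{\alpha_1,\alpha_2})\to C^\infty((0,1)\times S^2)$ is $$\mathcal{C}f(s,\theta)=\int_{B^3_{\alpha_1,\alpha_2}}\frac{\delta\left(|x|^2-(x\cdot\theta)^2-s\right)}{w(x,\theta)}f(x)\,dx,$$ with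 $\delta$ the Dirac delta. It is a Fourier integral operator with canonical relation $$C=\{((s,\alpha,\beta),(\sigma,2\sigma(x\cdot\theta_\alpha)(x\cdot\theta),2\sigma(x\cdot\theta_\beta)(x\cdot\theta));\,x,2\sigma(x-(x\cdot\theta)\theta)): x\in B^3_{\alpha_1,\alpha_2},\ s\in(0,1),\ \sigma\in\mathbb{R}\setminus 0,\ \theta\in S^2,\ |x|^2-(x\cdot\theta)^2-s=0\},$$ where $(\alpha,\beta)$ are local coordinates for $\theta\in S^2$, $\theta_\alpha=\partial_\alpha\theta$, $\theta_\beta=\partial_\beta\theta$. The right projection $\pi_R:C\to T^*B^3_{\alpha_1,\alpha_2}\setminus0$ sends such a point to $(x,2\sigma(x-(x\cdot\theta)\theta))$. The flowout of a submanifold $\Gamma=\{(x,\xi):p_i(x,\xi)=0,\ 1\le i\le k\}$ of $T^*X$ is $\{(x,\xi;y,\eta)\in T^*X\times T^*X:(x,\xi)\in\Gamma,\ (y,\eta)=\exp(\sum_{i=1}^kt_iH_{p_i})(x,\xi),\ t\in\mathbb{R}^k\}$, where $H_{p_i}$ is the Hamiltonian vector field of $p_i$. $\Delta(SO_3\times SO_3)$ denotes the diagonal of $SO_3\times SO_3$.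
   Formalization: Since s∈(0,1) forces |x|<1 on Σ, the displayed equality fails when α_2>1; it is proved as stated when α_2≤1, and in general with x∈B^3_{α_1,min(α_2,1)} in Λ. The flowout is taken with the components of x×ξ as the defining functions p_i. *)

(* Defs.v *)
From HB Require Import structures.
From mathcomp Require Import all_boot all_order all_algebra.
From mathcomp Require Import all_classical all_reals all_analysis.

Set Implicit Arguments.
Unset Strict Implicit.
Unset Printing Implicit Defensive.

Import Order.TTheory GRing.Theory Num.Theory.
Import numFieldNormedType.Exports.

Local Open Scope classical_set_scope.
Local Open Scope ring_scope.

Notation vec3 R := ('cV[R]_3).

(* T^*X, for X an open subset of R^3, is X x R^3, a subset of this space. *)
Notation phase_space R := ('cV[R]_3 * 'cV[R]_3)%type.

Section Geometry.
Variable R : realType.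
Implicit Types (x y u v xi : vec3 R).

Definition dot x y : R := \sum_(i < 3) x i 0 * y i 0.

(* Not `|x|, which is the sup norm of a matrix. *)
Definition enorm x : R := Num.sqrt (dot x x).

(* The index arithmetic takes place in the ring 'I_3 of integers modulo 3. *)
Definition cross x y : vec3 R :=
  \col_(i < 3) (x (i + 1) 0 * y (i + 2) 0 - x (i + 2) 0 * y (i + 1) 0).

Definition shell (a b : R) : set (vec3 R) := [set x | a < enorm x < b].

Definition SO3 : set 'M[R]_3 := [set O | O *m O^T = 1%:M /\ \det O = 1].

End Geometry.

(* f is C^oo on the open set U: all its iterated directional derivatives are
   differentiable at every point of U. *)
Definition smooth_on (R : realType) (V W : normedModType R) (U : set V)
    (f : V -> W) : Prop :=
  forall (vs : seq V) (u : V), U u ->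
    differentiable (foldr (fun v g => 'D_v g) f vs) u.

Section LocalCoordinates.
Variable R : realType.

Definition d_alpha (Th : R * R -> vec3 R) (ab : R * R) : vec3 R :=
  'D_((1, 0) : R * R) Th ab.

Definition d_beta (Th : R * R -> vec3 R) (ab : R * R) : vec3 R :=
  'D_((0, 1) : R * R) Th ab.

(* Local coordinates on the unit sphere, given by the inverse of the chart:
   Th is an injective immersion of the open set U into S^2. *)
Definition local_coordinates (U : set (R * R)) (Th : R * R -> vec3 R) : Prop :=
  [/\ open U,
      smooth_on U Th,
      (forall ab, U ab -> enorm (Th ab) = 1),
      {in U &, injective Th} &
      forall ab, U ab -> cross (d_alpha Th ab) (d_beta Th ab) != 0].

End LocalCoordinates.

Section CylinderTransform.
Variable R : realType.
Implicit Types (X : set (vec3 R)) (U : set (R * R)) (Th : R * R -> vec3 R).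

Definition alpha_of (eps : R) : R := 2 * eps / (1 - eps ^+ 2).

(* ((s, (alpha, beta)), (ds, (dalpha, dbeta)), (x, xi)): a covector of
   (0,1) x S^2 in coordinates (alpha, beta), and a covector of R^3. *)
Definition relation_space : Type :=
  ((R * (R * R)) * (R * (R * R)) * phase_space R)%type.

(* The part over U of the canonical relation of the weighted cylinder
   transform, in the local coordinates Th, for functions supported in X. *)
Definition canonical_relation X U Th : set relation_space :=
  [set c | exists (s : R) (ab : R * R) (sigma : R) (x : vec3 R),
    let theta := Th ab in
    let theta_a := d_alpha Th ab in
    let theta_b := d_beta Th ab in
    [/\ 0 < s < 1, U ab, sigma != 0, X x &
        dot x x - dot x theta ^+ 2 - s = 0] /\
    c = ((s, ab),
         (sigma, (2 * sigma * dot x theta_a * dot x theta,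
                  2 * sigma * dot x theta_b * dot x theta)),
         (x, (2 * sigma) *: (x - dot x theta *: theta)))].

Definition right_projection (c : relation_space) : phase_space R := c.2.

Definition Sigma X U Th : set relation_space :=
  canonical_relation X U Th `&`
  [set c | dot c.2.1 (Th c.1.1.2) = 0].

(* The image under the right projection of all of Sigma: the union over all
   local coordinates on S^2. *)
Definition piR_Sigma X : set (phase_space R) :=
  [set z | exists U Th, local_coordinates U Th /\
     (right_projection @` Sigma X U Th) z].

End CylinderTransform.

Section Flowout.
Variable R : realType.
Implicit Types (X : set (vec3 R)) (p : phase_space R -> R).

(* H_p = (dp/dxi, - dp/dx). *)
Definition hamiltonian_field p (z : phase_space R) : phase_space R :=
  (\col_(j < 3) 'D_((0, delta_mx j 0) : phase_space R) p z,
   - \col_(j < 3) 'D_((delta_mx j 0, 0) : phase_space R) p z).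

(* w = exp(V) z in T^*X: the integral curve of V issued from z exists in T^*X
   up to time 1, where it reaches w. *)
Definition exp_flow X (V : phase_space R -> phase_space R)
    (z w : phase_space R) : Prop :=
  exists g : R -> phase_space R,
    [/\ g 0 = z, g 1 = w &
        forall tau : R, 0 <= tau <= 1 ->
          X (g tau).1 /\ is_derive tau (1 : R) g (V (g tau))].

(* Gamma is the common zero set of the p i in T^*X \ 0. *)
Definition defined_by X k (p : 'I_k -> phase_space R -> R)
    (Gamma : set (phase_space R)) : Prop :=
  Gamma = [set z | [/\ X z.1, z.2 != 0 & forall i, p i z = 0]].

(* Flowout of Gamma by the functions p i; the time t i is absorbed in the
   vector field, so that the flow is taken at time 1. *)
Definition flowout X k (p : 'I_k -> phase_space R -> R)
    (Gamma : set (phase_space R)) : set (phase_space R * phase_space R) :=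
  [set q | Gamma q.1 /\ exists t : 'I_k -> R,
     exp_flow X (fun z => \sum_(i < k) t i *: hamiltonian_field (p i) z)
       q.1 q.2].

(* The components of x x xi, which cut out {x x xi = 0}. *)
Definition cross_components (i : 'I_3) (z : phase_space R) : R :=
  cross z.1 z.2 i 0.

(* (x, xi; O x, O xi): the same rotation O acts on both factors. *)
Definition Lambda X : set (phase_space R * phase_space R) :=
  [set q | exists (x xi : vec3 R) (O : 'M[R]_3),
    [/\ X x, xi != 0, cross x xi = 0, SO3 O &
        q = ((x, xi), (O *m x, O *m xi))]].

End Flowout.

(* Main.v *)
Require Import Defs.
From HB Require Import structures.
From mathcomp Require Import all_boot all_order all_algebra.
From mathcomp Require Import all_classical all_reals all_analysis.
From mathcomp Require Import ring lra.
Import Order.TTheory GRing.Theory Num.Theory.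
Import numFieldNormedType.Exports.
Local Open Scope classical_set_scope.
Local Open Scope ring_scope.

Set Implicit Arguments.
Unset Strict Implicit.
Unset Printing Implicit Defensive.

(* On Sigma, x . theta = 0 and |x|^2 = s < 1, so pi_R(Sigma) consists of the
   (x, 2 sigma x) with |x| < 1; conversely every such x has an orthogonal unit
   vector theta, around which spherical coordinates give a chart. The Hamiltonian
   field of t . (x cross xi) is (t cross x, t cross xi), so its flow rotates x and
   xi simultaneously about the axis t. It preserves |x| and, being skew, also
   |xi - c x|, hence the relation xi = c x; no uniqueness of integral curves is
   needed. Since xi = c x, only the image of x matters: SO_3 is transitive on
   spheres, and any two points of a sphere are joined by a rotation about a fixed
   axis orthogonal to the first one. *)

(** * Vector algebra in three dimensions *)

Lemma sum_ord3 (V : nmodType) (F : 'I_3 -> V) : \sum_(i < 3) F i = F 0 + F 1 + F 2.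
Proof.
rewrite !big_ord_recr big_ord0 /= add0r.
by congr (F _ + F _ + F _); apply: val_inj.
Qed.

Section Vectors.
Context {R : realType}.
Implicit Types (x y u v w n : vec3 R) (c : R).

Lemma forall_ord3 (P : 'I_3 -> Prop) : P 0 -> P 1 -> P 2 -> forall i, P i.
Proof.
move=> P0 P1 P2 [[|[|[|//]]] h].
- by rewrite (_ : Ordinal h = 0) //; apply: val_inj.
- by rewrite (_ : Ordinal h = 1) //; apply: val_inj.
- by rewrite (_ : Ordinal h = 2) //; apply: val_inj.
Qed.

Lemma vec3P x y : x 0 0 = y 0 0 -> x 1 0 = y 1 0 -> x 2 0 = y 2 0 -> x = y.
Proof.
by move=> *; apply/matrixP => i j; rewrite ord1; move: i; apply: forall_ord3.
Qed.

Lemma dotE x y : dot x y = x 0 0 * y 0 0 + x 1 0 * y 1 0 + x 2 0 * y 2 0.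
Proof. exact: sum_ord3. Qed.

Lemma cross0E x y : cross x y 0 0 = x 1 0 * y 2 0 - x 2 0 * y 1 0.
Proof. by rewrite mxE !add0r. Qed.

Lemma cross1E x y : cross x y 1 0 = x 2 0 * y 0 0 - x 0 0 * y 2 0.
Proof.
have e : (1 + 2 : 'I_3) = 0 by apply: val_inj.
by rewrite mxE e -mulr2n.
Qed.

Lemma cross2E x y : cross x y 2 0 = x 0 0 * y 1 0 - x 1 0 * y 0 0.
Proof.
have e1 : (2 + 1 : 'I_3) = 0 by apply: val_inj.
have e2 : (2 + 2 : 'I_3) = 1 by apply: val_inj.
by rewrite mxE e1 e2.
Qed.

Definition coordE := (dotE, cross0E, cross1E, cross2E).

Lemma dotC x y : dot x y = dot y x.
Proof. by rewrite !dotE; ring. Qed.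

Lemma dotDl x y u : dot (x + y) u = dot x u + dot y u.
Proof. by rewrite !dotE !mxE; ring. Qed.

Lemma dotZl c x y : dot (c *: x) y = c * dot x y.
Proof. by rewrite !dotE !mxE; ring. Qed.

Lemma dotDr x y u : dot u (x + y) = dot u x + dot u y.
Proof. by rewrite dotC dotDl !(dotC u). Qed.

Lemma dotZr c x y : dot x (c *: y) = c * dot x y.
Proof. by rewrite dotC dotZl dotC. Qed.

Lemma dot_ge0 x : 0 <= dot x x.
Proof. by rewrite dotE -!expr2 !addr_ge0 ?sqr_ge0. Qed.

Lemma dot_eq0 x : (dot x x == 0) = (x == 0).
Proof.
apply/idP/eqP => [|->]; last by rewrite dotE !mxE !mulr0 !addr0.
rewrite dotE -!expr2 !paddr_eq0 ?addr_ge0 ?sqr_ge0 // !sqrf_eq0.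
by move=> /andP[/andP[/eqP x0 /eqP x1] /eqP x2]; apply: vec3P; rewrite mxE.
Qed.

Lemma dot_gt0 x : (0 < dot x x) = (x != 0).
Proof. by rewrite lt_neqAle dot_ge0 andbT eq_sym dot_eq0. Qed.

Lemma cross_colinear c x : cross x (c *: x) = 0.
Proof. by apply: vec3P; rewrite !coordE !mxE; ring. Qed.

Lemma cross0r x : cross x 0 = 0.
Proof. by apply: vec3P; rewrite !coordE !mxE; ring. Qed.

Lemma crossZr c x y : cross x (c *: y) = c *: cross x y.
Proof. by apply: vec3P; rewrite [in RHS]mxE !coordE !mxE; ring. Qed.

Lemma crossZl c x y : cross (c *: x) y = c *: cross x y.
Proof. by apply: vec3P; rewrite [in RHS]mxE !coordE !mxE; ring. Qed.

Lemma crossDr x y u : cross u (x + y) = cross u x + cross u y.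
Proof. by apply: vec3P; rewrite [in RHS]mxE !coordE !mxE; ring. Qed.

Lemma crossDl x y u : cross (x + y) u = cross x u + cross y u.
Proof. by apply: vec3P; rewrite [in RHS]mxE !coordE !mxE; ring. Qed.

Lemma dot_crossr x y : dot y (cross x y) = 0.
Proof. by rewrite !coordE; ring. Qed.

Lemma dot_crossl x y : dot x (cross x y) = 0.
Proof. by rewrite !coordE; ring. Qed.

Lemma crosscross x y u : cross x (cross y u) = dot x u *: y - dot x y *: u.
Proof. by apply: vec3P; rewrite [in RHS]mxE !coordE !mxE; ring. Qed.

(** Lagrange's identity. It yields Cauchy-Schwarz, the length of [cross x y], and later the
    immersion condition for a chart. *)
Lemma dot_cross_cross x y :
  dot (cross x y) (cross x y) = dot x x * dot y y - dot x y ^+ 2.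
Proof. by rewrite !coordE; ring. Qed.

(** Expand the vanishing double product [cross x (cross x y)] and divide by [dot x x]. *)
Lemma cross_eq0_colinear x y : x != 0 -> cross x y = 0 ->
  y = (dot x y / dot x x) *: x.
Proof.
rewrite -dot_eq0 => x0 xy; have := crosscross x x y; rewrite xy cross0r.
move=> /esym/eqP; rewrite subr_eq0 => /eqP e.
by rewrite mulrC -scalerA e scalerA mulVf // scale1r.
Qed.

Lemma dot_normalize x : x != 0 ->
  dot ((enorm x)^-1 *: x) ((enorm x)^-1 *: x) = 1.
Proof.
move=> x0; rewrite dotZl dotZr mulrA -invfM -expr2 sqr_sqrtr ?dot_ge0 //.
by rewrite mulVf // dot_eq0.
Qed.

Lemma unit_orthogonal x : exists2 n, dot n n = 1 & dot n x = 0.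
Proof.
suff [m m0 mx] : exists2 m, m != 0 & dot m x = 0.
  exists ((enorm m)^-1 *: m); first exact: dot_normalize.
  by rewrite dotZl mx mulr0.
(* If the middle coordinate of [x] vanishes, the middle basis vector is orthogonal to [x]. Otherwise
   the product of [x] with the first basis vector has last entry [- x 1 0], hence is nonzero. *)
have [x10|x10] := eqVneq (x 1 0) 0.
  exists (delta_mx 1 0); last by rewrite dotE !mxE x10 /=; ring.
  by apply/eqP => /matrixP/(_ 1 0)/eqP; rewrite !mxE !eqxx oner_eq0.
exists (cross x (delta_mx 0 0)); last by rewrite dotC dot_crossl.
apply/eqP => /matrixP/(_ 2 0)/eqP; rewrite !coordE !mxE !eqxx /=.
by rewrite mulr0 sub0r mulr1 oppr_eq0 (negbTE x10).
Qed.

(** * Rotations *)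

Lemma SO3_dot (O : 'M[R]_3) x y : SO3 O -> dot (O *m x) (O *m y) = dot x y.
Proof.
have dot_mx u v : dot u v = (u^T *m v) 0 0.
  by rewrite mxE; apply: eq_bigr => i _; rewrite mxE.
move=> -[/mulmx1C OO _]; rewrite !dot_mx trmx_mul -mulmxA (mulmxA O^T) OO.
by rewrite mul1mx.
Qed.

Lemma det_mx3 (M : 'M[R]_3) : \det M =
  M 0 0 * (M 1 1 * M 2 2 - M 1 2 * M 2 1) - M 0 1 * (M 1 0 * M 2 2 - M 1 2 * M 2 0)
  + M 0 2 * (M 1 0 * M 2 1 - M 1 1 * M 2 0).
Proof.
(* Entries are indexed by natural numbers so that the lifted ordinals in the minors reduce by
   computation. *)
pose f (i j : nat) := M (inord i) (inord j).
have fE i j : M i j = f i j by rewrite /f !inord_val.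
rewrite (expand_det_row _ ord0) !big_ord_recr big_ord0 /= add0r /cofactor.
rewrite !(expand_det_row _ ord0) !big_ord_recr !big_ord0 /= !add0r /cofactor.
by rewrite !det_mx11 !mxE !fE /=; ring.
Qed.

(** The matrix is the rotation by pi about [u]. It is symmetric and squares to the identity, hence
    is orthogonal. *)
Lemma SO3_half_turn u : dot u u = 1 -> SO3 (2 *: (u *m u^T) - 1%:M).
Proof.
move=> u1; have uu : u^T *m u = 1%:M.
  by apply/matrixP => i j; rewrite !ord1 -u1 !mxE; apply: eq_bigr => k _; rewrite mxE.
split; last first.
  (* For every [u], the determinant equals the polynomial [2 * dot u u - 1]. *)
  transitivity (2 * dot u u - 1); last by rewrite u1; ring.
  by rewrite det_mx3 dotE !mxE !big_ord1 !mxE /=; ring.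
rewrite linearB /= linearZ /= trmx_mul trmxK tr_scalar_mx.
rewrite mulmxBl mul1mx mulmxBr mulmx1 -!scalemxAr -scalemxAl -mulmxA.
rewrite (mulmxA u^T) uu mul1mx scalerA.
by move: (u *m u^T) => A; apply/matrixP => i j; rewrite !mxE; ring.
Qed.

(* The half-turn about x + y maps x to y; if x + y = 0, any half-turn about an
   axis orthogonal to x does. *)
Lemma SO3_transitive x y : dot x x = dot y y ->
  exists2 O : 'M[R]_3, SO3 O & O *m x = y.
Proof.
move=> xy.
have half u : (2 *: (u *m u^T) - 1%:M) *m x = (2 * dot u x) *: u - x.
  rewrite mulmxBl mul1mx -scalemxAl -mulmxA -scalerA; congr (_ *: _ - _).
  apply/matrixP => i j; rewrite !ord1 !mxE big_ord1 mxE mulrC /dot; congr (_ * _).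
  by apply: eq_bigr => k _; rewrite mxE.
have [/eqP|w0] := eqVneq (x + y) 0.
  rewrite addr_eq0 => /eqP yx.
  have [n n1 nx] := unit_orthogonal x.
  exists (2 *: (n *m n^T) - 1%:M); first exact: SO3_half_turn.
  by rewrite half nx mulr0 scale0r yx sub0r opprK.
(* Equality of the two lengths makes the projection of [x] on the axis equal to (x + y)/2, so the
   half-turn sends [x] to (x + y) - x. *)
have ww : dot (x + y) (x + y) = 2 * dot (x + y) x.
  by rewrite !dotDl !dotDr (dotC y x) -xy; ring.
set u := (enorm (x + y))^-1 *: (x + y).
exists (2 *: (u *m u^T) - 1%:M); first exact/SO3_half_turn/dot_normalize.
rewrite half /u dotZl scalerA.
have -> : 2 * ((enorm (x + y))^-1 * dot (x + y) x) / enorm (x + y) =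
    2 * dot (x + y) x / enorm (x + y) ^+ 2 by rewrite expr2 invfM; ring.
by rewrite sqr_sqrtr ?dot_ge0 // -ww divff ?dot_eq0 // scale1r addrC addKr.
Qed.

(** For an axis orthogonal to [x], Rodrigues' formula reduces to the right-hand side. The angle is
    the one between [x] and [y], the axis their normalized cross product. *)
Lemma cross_rotation x y : x != 0 -> dot x x = dot y y ->
  exists n a, [/\ dot n n = 1, dot n x = 0 & y = cos a *: x + sin a *: cross n x].
Proof.
move=> x0 xy; pose c := dot x y / dot x x.
have xx : 0 < dot x x by rewrite dot_gt0.
(* Cauchy-Schwarz, from Lagrange's identity and the equality of the lengths. *)
have c2 : c ^+ 2 <= 1.
  rewrite expr_div_n ler_pdivrMr ?exprn_gt0 // mul1r -subr_ge0.
  by rewrite {1}expr2 {2}xy -dot_cross_cross dot_ge0.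
have c1 : -1 <= c <= 1 by apply/andP; split; nra.
have ca : cos (acos c) = c by rewrite acosK // in_itv.
have xyE : enorm (cross x y) = dot x x * sin (acos c).
  rewrite sin_acos // /enorm dot_cross_cross -[in RHS](ger0_norm (ltW xx)).
  rewrite -sqrtr_sqr -sqrtrM ?sqr_ge0 // -xy; congr Num.sqrt.
  by rewrite /c; field; rewrite gt_eqF.
(* When the sine vanishes, [x] and [y] are collinear and any unit vector orthogonal to [x] serves as
   axis. *)
have [s0|s0] := eqVneq (sin (acos c)) 0.
  have [n n1 nx] := unit_orthogonal x.
  exists n, (acos c); split=> //; rewrite ca s0 scale0r addr0.
  apply: cross_eq0_colinear => //; apply/eqP.
  by rewrite -dot_eq0 -[dot _ _]sqr_sqrtr ?dot_ge0 // -/(enorm _) xyE s0 mulr0 expr0n.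
have xy0 : cross x y != 0.
  apply: contra_neq s0 => xy0; apply: (mulfI (lt0r_neq0 xx)).
  rewrite -xyE xy0 mulr0 /enorm (_ : dot 0 0 = 0) ?sqrtr0 //; apply/eqP.
  by rewrite dot_eq0.
exists ((enorm (cross x y))^-1 *: cross x y), (acos c); split.
- exact: dot_normalize.
- by rewrite dotZl dotC dot_crossl mulr0.
rewrite ca crossZl scalerA xyE invfM mulrCA divff // mulr1.
have -> : cross (cross x y) x = dot x x *: y - dot x y *: x.
  by apply: vec3P; rewrite !coordE !mxE; ring.
rewrite scalerBr !scalerA mulVf ?gt_eqF // scale1r mulrC -/c.
by rewrite addrC subrK.
Qed.

End Vectors.

(** * Directional derivatives *)

Section Derivatives.

(** The difference quotient is constantly [d]. This suits the components of the cross product, which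
    are affine along each coordinate direction of phase space. *)
Lemma derive_affine {K : numFieldType} {V W : normedModType K} (f : V -> W) x v d :
  (forall h, f (h *: v + x) = f x + h *: d) -> 'D_v f x = d.
Proof.
move=> fh; apply: cvg_lim => //; apply/cvgrPdist_lt => e e0.
near=> h; rewrite /= fh [_ + _ - f x]addrC addKr scalerA mulVf.
  by rewrite scale1r subrr normr0.
by near: h; exact: nbhs_dnbhs_neq.
Unshelve. all: by end_near. Qed.

(** [L] commutes with the difference quotients and, being continuous, with their limit. Only the one
    directional derivative of [f] enters. *)
Lemma is_derive_linear {K : numFieldType} {U V W : normedModType K} (L : V -> W)
    (f : U -> V) x v df :
  linear L -> continuous L -> is_derive x v f df ->
  is_derive x v (L \o f) (L df).
Proof.
move=> Ll Lc [fx fv].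
have LB u w : L (u - w) = L u - L w by rewrite addrC -scaleN1r Ll scaleN1r addrC.
have L0 : L 0 = 0 by have := LB 0 0; rewrite !subrr.
have LZ k u : L (k *: u) = k *: L u by rewrite -[_ *: u]addr0 Ll L0 addr0.
have cL : (fun h => h^-1 *: (((L \o f) \o shift x) (h *: v) - (L \o f) x)) @ 0^'
    --> L df.
  rewrite -fv; under eq_fun do rewrite /= -LB -LZ.
  by apply: continuous_cvg; [exact: Lc | exact: fx].
by apply: DeriveDef; [exact: cvgP cL | exact: cvg_lim cL].
Qed.

Context {R : realType}.

Lemma is_deriveZl {V W : normedModType R} (k : V -> R) (w : W) x v dk :
  is_derive x v k dk -> is_derive x v (fun y => k y *: w) (dk *: w).
Proof.
move=> kx; apply: (@is_derive_linear _ V R^o W ( *:%R ^~ w) k x v dk _ _ kx);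
  last exact: scalel_continuous.
by move=> a b c; rewrite scalerDl scalerA.
Qed.

Lemma is_derive_coord {V : normedModType R} (f : V -> vec3 R) x v df i :
  is_derive x v f df -> is_derive x v (fun y => f y i 0) (df i 0).
Proof.
move=> fx; apply: (@is_derive_linear _ V (vec3 R) R^o (fun u => u i 0) f x v df _ _ fx);
  last exact: coord_continuous.
by move=> a b c; rewrite !mxE.
Qed.

Lemma is_derive_dot {V : normedModType R} (f g : V -> vec3 R) x v df dg :
  is_derive x v f df -> is_derive x v g dg ->
  is_derive x v (fun y => dot (f y) (g y)) (dot df (g x) + dot (f x) dg).
Proof.
move=> /is_derive_coord fx /is_derive_coord gx.
under eq_fun do rewrite dotE.
have M i : is_derive x v (fun y => f y i 0 * g y i 0)
    (f x i 0 * dg i 0 + g x i 0 * df i 0).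
  exact: is_deriveM.
apply: (is_derive_eq (is_deriveD (is_deriveD (M 0) (M 1)) (M 2))).
by rewrite !dotE; ring.
Qed.

(** Mean value theorem, with the derivative given on the closed interval, as [exp_flow] supplies
    it. *)
Lemma is_derive0_eq (f : R -> R) :
  (forall tau : R, 0 <= tau <= 1 -> is_derive tau 1 f 0) -> f 1 = f 0.
Proof.
move=> f0.
have [|||c _] := @MVT_segment R f (cst 0) 0 1 => //.
- by move=> tau; rewrite in_itv /= => /andP[t0 t1]; apply: f0; rewrite !ltW.
- by apply: derivable_within_continuous => tau; rewrite in_itv /= => /f0[].
- by move=> /eqP; rewrite mul0r subr_eq0 => /eqP.
Qed.

End Derivatives.

(** * The Hamiltonian flow of the components of the cross product *)

Section Flow.
Context {R : realType}.
Implicit Types (x n t : vec3 R) (z : phase_space R).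

Lemma derive_cross_xi i j z :
  'D_((0, delta_mx j 0) : phase_space R) (@cross_components R i) z =
  cross z.1 (delta_mx j 0) i 0.
Proof.
apply: derive_affine => h.
rewrite /cross_components /= scaler0 add0r addrC crossDr crossZr.
by rewrite mxE [in X in _ + X = _]mxE.
Qed.

Lemma derive_cross_x i j z :
  'D_((delta_mx j 0, 0) : phase_space R) (@cross_components R i) z =
  cross (delta_mx j 0) z.2 i 0.
Proof.
apply: derive_affine => h.
rewrite /cross_components /= scaler0 add0r addrC crossDl crossZl.
by rewrite mxE [in X in _ + X = _]mxE.
Qed.

(** By cyclicity of the triple product, (x × e_j)_i = (e_i × x)_j and -(e_j × ξ)_i = (e_i × ξ)_j, so
    the field of the i-th component is the infinitesimal rotation about e_i on both factors. *)
Lemma hamiltonian_cross (t : 'I_3 -> R) z :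
  \sum_(i < 3) t i *: hamiltonian_field (@cross_components R i) z =
  (cross (\col_i t i) z.1, cross (\col_i t i) z.2).
Proof.
have E i : hamiltonian_field (@cross_components R i) z =
    (cross (delta_mx i 0) z.1, cross (delta_mx i 0) z.2).
  congr (_, _); apply/matrixP => j k; rewrite ord1.
    rewrite [LHS]mxE derive_cross_xi.
    by move: i j; do 2! apply: forall_ord3; rewrite !coordE !mxE /=; ring.
  rewrite [LHS]mxE [in LHS]mxE derive_cross_x.
  by move: i j; do 2! apply: forall_ord3; rewrite !coordE !mxE /=; ring.
have C x : \sum_i t i *: cross (delta_mx i 0) x = cross (\col_i t i) x.
  rewrite sum_ord3 -!crossZl -!crossDl; congr (cross _ x).
  by apply: vec3P; rewrite !mxE /=; ring.
under eq_bigr do rewrite E.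
by rewrite [LHS]surjective_pairing !linear_sum /= !C.
Qed.

Lemma exp_flow_cross_preserves (X : set (vec3 R)) (t : 'I_3 -> R) c z w :
  exp_flow X (fun z => \sum_(i < 3) t i *: hamiltonian_field (@cross_components R i) z)
    z w ->
  z.2 = c *: z.1 -> dot w.1 w.1 = dot z.1 z.1 /\ w.2 = c *: w.1.
Proof.
move=> [g [<- <- gX]] zc; set T := \col_i t i.
have dg (tau : R) : 0 <= tau <= 1 ->
    is_derive tau (1 : R) g (cross T (g tau).1, cross T (g tau).2).
  by move=> /gX[_]; rewrite hamiltonian_cross.
have d1 (tau : R) : 0 <= tau <= 1 -> is_derive tau (1 : R) (fst \o g) (cross T (g tau).1).
  move=> /dg; apply: (@is_derive_linear _ R^o (phase_space R) (vec3 R) fst); first by [].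
  by move=> ?; exact: cvg_fst.
have d2 (tau : R) : 0 <= tau <= 1 -> is_derive tau (1 : R) (snd \o g) (cross T (g tau).2).
  move=> /dg; apply: (@is_derive_linear _ R^o (phase_space R) (vec3 R) snd); first by [].
  by move=> ?; exact: cvg_snd.
have dot_cst (f : R -> vec3 R) :
    (forall tau : R, 0 <= tau <= 1 -> is_derive tau (1 : R) f (cross T (f tau))) ->
    dot (f 1) (f 1) = dot (f 0) (f 0).
  move=> df; apply: (is_derive0_eq (f := fun s => dot (f s) (f s))) => tau /df dft.
  apply: (is_derive_eq (is_derive_dot dft dft)).
  by rewrite dotC dot_crossr addr0.
split; first exact: (dot_cst (fst \o g)).
(* This difference obeys the same linear equation as both factors, so its length is constant; it
   starts at 0. *)
pose f s := (g s).2 - c *: (g s).1.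
have f1 : dot (f 1) (f 1) = dot (f 0) (f 0).
  apply: dot_cst => tau t01; rewrite /f crossDr -scaleN1r !crossZr scaleN1r.
  by apply: is_deriveB; [exact: d2 | apply: is_deriveZ; exact: d1].
apply/eqP; rewrite -subr_eq0 -dot_eq0 -/(f 1) f1.
by rewrite /f zc subrr dot_eq0.
Qed.

(** The integral curve is the rotation at constant speed [a] about [n]. It stays on the sphere
    through [x], which the hypothesis places in [X]. *)
Lemma exp_flow_cross_rotation (X : set (vec3 R)) n x c a :
  dot n n = 1 -> dot n x = 0 -> (forall y, dot y y = dot x x -> X y) ->
  let y := cos a *: x + sin a *: cross n x in
  exists t : 'I_3 -> R,
  exp_flow X (fun z => \sum_(i < 3) t i *: hamiltonian_field (@cross_components R i) z)
    (x, c *: x) (y, c *: y).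
Proof.
move=> n1 nx Xs y; exists (fun i => a * n i 0).
pose r s := cos s *: x + sin s *: cross n x.
pose r' s := - sin s *: x + cos s *: cross n x.
have rr s : dot (r s) (r s) = dot x x.
  rewrite /r !dotDl !dotDr !dotZl !dotZr dot_cross_cross dot_crossr.
  rewrite (dotC _ x) dot_crossr n1 nx.
  transitivity ((cos s ^+ 2 + sin s ^+ 2) * dot x x); first by ring.
  by rewrite cos2Dsin2 mul1r.
(* The equation of motion in the angle variable; orthogonality of [n] to [x] and its unit length
   enter here. *)
have nr s : cross n (r s) = r' s.
  rewrite /r /r' crossDr !crossZr crosscross nx n1 scale0r sub0r scale1r scalerN.
  by rewrite scaleNr addrC.
exists (fun s => (r (s * a), c *: r (s * a))); split.
- by rewrite /r mul0r cos0 sin0 scale1r scale0r addr0.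
- by rewrite mul1r.
move=> tau _; split; first by apply: Xs; rewrite /= rr.
rewrite hamiltonian_cross /= crossZr.
have -> : \col_i (a * n i 0) = a *: n by apply/matrixP => i j; rewrite !mxE ord1.
rewrite crossZl nr.
have ma : is_derive tau (1 : R) ( *%R^~ a) a.
  by apply: (is_derive_eq (@is_deriveZl R R^o R^o id a tau 1 1 _));
    rewrite /GRing.scale /= mul1r.
have dc := @is_deriveZl _ _ (phase_space R) _ (x, c *: x) _ _ _
  (is_derive1_comp (is_derive_cos _) ma).
have ds := @is_deriveZl _ _ (phase_space R) _ (cross n x, c *: cross n x) _ _ _
  (is_derive1_comp (is_derive_sin _) ma).
(* The curve is a combination of two fixed phase-space vectors, so only its scalar coefficients have
   to be differentiated. *)
have E (k l : R) : (k *: x + l *: cross n x, c *: (k *: x + l *: cross n x)) =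
    k *: (x, c *: x) + l *: (cross n x, c *: cross n x) :> phase_space R.
  rewrite [RHS]surjective_pairing /=; congr (_, _).
  by rewrite scalerDr !scalerA !(mulrC c).
under eq_fun do rewrite /r E.
apply: (is_derive_eq (is_deriveD dc ds)).
by rewrite /r' scalerDr !scalerA E !(mulrC a).
Qed.

End Flow.

(** * Local coordinates on the sphere *)

Section Charts.
Context {R : realType}.
Implicit Types (ab v : R * R) (k : R -> R).

Lemma differentiable_fst ab : differentiable (fst : R * R -> R) ab.
Proof. by apply: linear_differentiable => p; exact: cvg_fst. Qed.

Lemma differentiable_snd ab : differentiable (snd : R * R -> R) ab.
Proof. by apply: linear_differentiable => p; exact: cvg_snd. Qed.

Lemma differentiable_comp_fst k ab : derivable k ab.1 1 ->
  differentiable (fun p : R * R => k p.1) ab.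
Proof.
move=> /derivable1_diffP kd.
by apply: (differentiable_comp (differentiable_fst ab)).
Qed.

Lemma differentiable_comp_snd k ab : derivable k ab.2 1 ->
  differentiable (fun p : R * R => k p.2) ab.
Proof.
move=> /derivable1_diffP kd.
by apply: (differentiable_comp (differentiable_snd ab)).
Qed.

Lemma is_derive_comp_fst k ab v dk : is_derive ab.1 (1 : R) k dk ->
  is_derive ab v (fun p : R * R => k p.1) (v.1 * dk).
Proof.
move=> kd; have kd1 : differentiable k ab.1 by apply/derivable1_diffP.
apply: DeriveDef; first exact/diff_derivable/differentiable_comp_fst.
rewrite deriveE; last exact: differentiable_comp_fst.
rewrite (diff_comp (differentiable_fst ab) kd1) /=.
rewrite (@diff_lin _ _ _ fst) => [|p]; last exact: cvg_fst.
by rewrite diff1E // derive1E derive_val.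
Qed.

Lemma is_derive_comp_snd k ab v dk : is_derive ab.2 (1 : R) k dk ->
  is_derive ab v (fun p : R * R => k p.2) (v.2 * dk).
Proof.
move=> kd; have kd1 : differentiable k ab.2 by apply/derivable1_diffP.
apply: DeriveDef; first exact/diff_derivable/differentiable_comp_snd.
rewrite deriveE; last exact: differentiable_comp_snd.
rewrite (diff_comp (differentiable_snd ab) kd1) /=.
rewrite (@diff_lin _ _ _ snd) => [|p]; last exact: cvg_snd.
by rewrite diff1E // derive1E derive_val.
Qed.

(* A family containing the spherical coordinates and closed under directional
   derivatives, which makes all of its members smooth. *)
Definition trig_map (A B C D E F : vec3 R) ab : vec3 R :=
  (cos ab.1 * cos ab.2) *: A + (sin ab.1 * cos ab.2) *: B +
  (cos ab.1 * sin ab.2) *: C + (sin ab.1 * sin ab.2) *: D +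
  cos ab.2 *: E + sin ab.2 *: F.

Lemma differentiable_trig_map A B C D E F ab :
  differentiable (trig_map A B C D E F) ab.
Proof.
have dc (x : R) : derivable cos x 1 by [].
have ds (x : R) : derivable sin x 1 by [].
have c1 := differentiable_comp_fst (dc ab.1).
have c2 := differentiable_comp_snd (dc ab.2).
have s1 := differentiable_comp_fst (ds ab.1).
have s2 := differentiable_comp_snd (ds ab.2).
by rewrite /trig_map; do 5? apply: differentiableD; apply: differentiableZl => //;
  apply: differentiableM.
Qed.

(** Each partial derivative sends every trigonometric factor of the family to another one up to
    sign, or to zero; the new coefficients collect the terms. *)
Lemma is_derive_trig_map A B C D E F ab v :
  is_derive ab v (trig_map A B C D E F)
    (trig_map (v.1 *: B + v.2 *: C) (v.2 *: D - v.1 *: A) (v.1 *: D - v.2 *: A)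
              (- (v.1 *: C + v.2 *: B)) (v.2 *: F) (- (v.2 *: E)) ab).
Proof.
have c1 := is_derive_comp_fst v (is_derive_cos ab.1).
have c2 := is_derive_comp_snd v (is_derive_cos ab.2).
have s1 := is_derive_comp_fst v (is_derive_sin ab.1).
have s2 := is_derive_comp_snd v (is_derive_sin ab.2).
apply: (is_derive_eq
  (is_deriveD (is_deriveD (is_deriveD (is_deriveD (is_deriveD
     (is_deriveZl A (is_deriveM c1 c2)) (is_deriveZl B (is_deriveM s1 c2)))
     (is_deriveZl C (is_deriveM c1 s2))) (is_deriveZl D (is_deriveM s1 s2)))
     (is_deriveZl E c2)) (is_deriveZl F s2))).
by rewrite /trig_map; apply/matrixP => i j; rewrite !mxE /GRing.scale /=; ring.
Qed.

Lemma smooth_trig_map U A B C D E F : smooth_on U (trig_map A B C D E F).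
Proof.
move=> vs u _.
suff [A' [B' [C' [D' [E' [F' ->]]]]]] : exists A' B' C' D' E' F',
    foldr (fun v g => 'D_v g) (trig_map A B C D E F) vs = trig_map A' B' C' D' E' F'.
  exact: differentiable_trig_map.
elim: vs => [|v vs [A' [B' [C' [D' [E' [F' /= ->]]]]]]]; first by do 6! eexists.
do 6! eexists; apply/funext => ab.
exact: (@derive_val _ _ _ _ _ _ _ (is_derive_trig_map _ _ _ _ _ _ ab v)).
Qed.

(** Spherical coordinates in an orthonormal frame (theta, e, f), with [theta] at the origin of the
    chart. On the open square of half-side pi/2 the sine is injective and the cosine positive. *)
Lemma local_coordinates_at (theta : vec3 R) : dot theta theta = 1 ->
  exists U Th ab, [/\ local_coordinates U Th, U ab & Th ab = theta].
Proof.
move=> th1; have [e e1 eth] := unit_orthogonal theta; set f := cross theta e.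
have f1 : dot f f = 1 by rewrite dot_cross_cross th1 e1 dotC eth; ring.
have fth : dot theta f = 0 by rewrite dot_crossl.
have fe : dot e f = 0 by rewrite dot_crossr.
have the : dot theta e = 0 by rewrite dotC.
have fth' : dot f theta = 0 by rewrite dotC.
have fe' : dot f e = 0 by rewrite dotC.
pose dotsE := (dotDl, dotDr, dotZl, dotZr, th1, e1, f1, fth, fe, the, fth', fe', eth).
pose I : set R := `](- (pi / 2)), (pi / 2)[%classic.
pose U : set (R * R) := [set ab | I ab.1 /\ I ab.2].
pose Th ab := (cos ab.1 * cos ab.2) *: theta + (sin ab.1 * cos ab.2) *: e +
  sin ab.2 *: f.
have ThE : Th = trig_map theta e 0 0 0 f.
  by apply/funext => ab; rewrite /Th /trig_map !scaler0 !addr0.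
exists U, Th, (0, 0); split; last first.
- by rewrite /Th /= cos0 sin0 !mul0r !scale0r !addr0 mulr1 scale1r.
- have pi0 : 0 < pi / 2 :> R by rewrite divr_gt0 ?pi_gt0.
  by split; rewrite /I /= in_itv /= oppr_lt0 pi0.
have cs1 (a : R) := cos2Dsin2 a.
have cos0 (b : R) : I b -> cos b != 0.
  by rewrite /I /= in_itv /= => /cos_gt0_pihalf /gt_eqF ->.
have sI : {in I &, injective (@sin R)}.
  have II a : I a -> a \in `[- (pi / 2), pi / 2].
    by rewrite /I /= in_itv /= in_itv /= => /andP[? ?]; rewrite !ltW.
  by move=> a b /set_mem /II aI /set_mem /II bI; exact: sin_inj.
split.
- have Io : open I by exact: itv_open.
  apply: openI; apply: open_comp => //= p _; [exact: cvg_fst | exact: cvg_snd].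
- by rewrite ThE; exact: smooth_trig_map.
- move=> ab _; rewrite /enorm /Th !dotsE -[RHS]sqrtr1; congr Num.sqrt.
  transitivity ((cos ab.1 ^+ 2 + sin ab.1 ^+ 2) * cos ab.2 ^+ 2 + sin ab.2 ^+ 2).
    by ring.
  by rewrite cs1 mul1r cs1.
(* The component along [f] determines the second angle; the component along [e], divided by the
   nonzero cosine of that angle, then determines the first. *)
- move=> p q /set_mem [p1 p2] /set_mem [q1 q2] pq.
  have e2 : p.2 = q.2.
    apply: sI; rewrite ?inE //.
    have := congr1 (dot f) pq; rewrite /Th !dotsE.
    by rewrite !mulr0 !add0r !mulr1.
  have e1' : p.1 = q.1.
    apply: sI; rewrite ?inE //.
    have := congr1 (dot e) pq; rewrite /Th !dotsE.
    rewrite !mulr0 !add0r !addr0 !mulr1 e2.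
    by apply: mulIf; exact: cos0.
  by rewrite (surjective_pairing p) e1' e2 -surjective_pairing.
move=> ab [_ /cos0 c0].
rewrite -dot_eq0 dot_cross_cross /d_alpha /d_beta ThE.
rewrite !(@derive_val _ _ _ _ _ _ _ (is_derive_trig_map _ _ _ _ _ _ ab _)).
rewrite /trig_map /= !(scale0r, scaler0, addr0, add0r, scale1r, oppr0, subr0, sub0r).
rewrite !scalerN -!scaleNr !dotsE /GRing.scale /=.
(* The squared length of the normal reduces to the squared cosine of the second angle. *)
rewrite (_ : _ + _ = ((cos ab.1 ^+ 2 + sin ab.1 ^+ 2) ^+ 2 * sin ab.2 ^+ 2 +
    (cos ab.1 ^+ 2 + sin ab.1 ^+ 2) * cos ab.2 ^+ 2) * cos ab.2 ^+ 2); last by ring.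
by rewrite cs1 expr1n !mul1r addrC cs1 mul1r expf_neq0.
Qed.

End Charts.

(** * The image of Sigma under the right projection *)

Section Sigma.
Context {R : realType}.
Implicit Types (x y : vec3 R) (X : set (vec3 R)) (z : phase_space R).

Lemma enorm_lt1 x : (enorm x < 1) = (dot x x < 1).
Proof. by rewrite /enorm -{1}sqrtr1 ltr_sqrt. Qed.

Lemma shell_min1 (a b : R) x :
  shell a (Num.min b 1) x <-> shell a b x /\ dot x x < 1.
Proof.
rewrite /shell /= lt_min enorm_lt1.
by split => [/and3P[-> -> ->]|[/andP[-> ->] ->]].
Qed.

(** Excluding the origin makes 2σx nonzero in one direction and allows ξ to be written as a multiple
    of x in the other. *)
Lemma piR_SigmaE X z : ~ X 0 ->
  piR_Sigma X z <-> [/\ X z.1, dot z.1 z.1 < 1, z.2 != 0 & cross z.1 z.2 = 0].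
Proof.
move=> X0; split.
  move=> [U [Th [_ [c [[s [ab [sigma [x [[/andP[_ s1] _ s0 Xx xs] ->]]]]] /= xth] <-]]]].
  rewrite /right_projection /=; move: xs; rewrite xth scale0r subr0 expr0n subr0 => /eqP.
  rewrite subr_eq0 => /eqP ->; split=> //; last by rewrite cross_colinear.
  rewrite scaler_eq0 !mulf_eq0 (negbTE s0) pnatr_eq0 /=.
  by apply: contra_notN X0 => /eqP <-.
case: z => x xi /= [Xx x1 xi0 xxi].
have x0 : x != 0 by apply: contra_notN X0 => /eqP <-.
have [n n1 nx] := unit_orthogonal x.
have [U [Th [ab [Thl Uab Thn]]]] := local_coordinates_at n1.
have xn : dot x (Th ab) = 0 by rewrite Thn dotC.
exists U, Th; split=> //.
have xiE := cross_eq0_colinear x0 xxi; set c := _ / _ in xiE.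
have c0 : c != 0 by apply: contra_neq xi0 => c0; rewrite xiE c0 scale0r.
(* The equation of the relation forces s = |x|^2 when x . theta = 0, and σ = c/2 gives 2σx = cx =
   ξ. *)
exists ((dot x x, ab), (c / 2, (2 * (c / 2) * dot x (d_alpha Th ab) * dot x (Th ab),
   2 * (c / 2) * dot x (d_beta Th ab) * dot x (Th ab))),
   (x, (2 * (c / 2)) *: (x - dot x (Th ab) *: Th ab))); last first.
  by rewrite /right_projection /= xn scale0r subr0 mulrC divfK ?pnatr_eq0 // -xiE.
split=> //; exists (dot x x), ab, (c / 2), x; split=> //; split=> //.
- by rewrite dot_gt0 x0.
- by rewrite mulf_neq0 // invr_eq0 pnatr_eq0.
- by rewrite xn expr0n subr0 subrr.
Qed.

Lemma shell_dot (a b : R) x y : dot x x = dot y y -> shell a b x -> shell a b y.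
Proof. by rewrite /shell /= /enorm => ->. Qed.

Lemma shell_not0 (a b : R) : 0 < a -> ~ shell a b 0.
Proof.
move=> a0; rewrite /shell /= /enorm (_ : dot 0 0 = 0) ?sqrtr0; last first.
  by apply/eqP; rewrite dot_eq0.
by move=> /andP[/(lt_trans a0)]; rewrite ltxx.
Qed.

End Sigma.

(** * Defining equations and flowout *)

Theorem corollary1 (R : realType) (eps1 eps2 : R)
    (h1 : 0 < eps1) (h12 : eps1 < eps2) (h2 : eps2 < 1) :
  let a1 := alpha_of eps1 in
  let a2 := alpha_of eps2 in
  let B := shell a1 a2 in
  let B' := shell a1 (Num.min a2 1) in
  let Gamma := piR_Sigma B in
  let p := @cross_components R in
  (a2 <= 1 ->
     defined_by B p Gamma /\ flowout B p Gamma = Lambda B) /\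
  (defined_by B' p Gamma /\ flowout B p Gamma = Lambda B').
Proof.
move=> a1 a2 B B' Gamma p.
(* The constraint s < 1 truncates the shell at radius 1. For [a2 <= 1] the truncation is vacuous and
   the general statement specializes. *)
suff H : defined_by B' p Gamma /\ flowout B p Gamma = Lambda B'.
  by split=> // a21; have BB : B' = B; [rewrite /B' min_l | rewrite BB in H].
have a10 : 0 < a1.
  rewrite /a1 /alpha_of divr_gt0 ?mulr_gt0 // subr_gt0 expr_lt1 // ?ltW //.
  exact: lt_trans h2.
have B0 : ~ B 0 by exact: shell_not0.
have GammaE z : Gamma z <-> [/\ B' z.1, z.2 != 0 & cross z.1 z.2 = 0].
  rewrite /Gamma (piR_SigmaE _ B0); split.
    by move=> [Bz z1 z20 zz]; split=> //; apply/shell_min1.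
  by move=> [/shell_min1[Bz z1] z20 zz].
split.
  apply/seteqP; split=> z.
    by move=> /GammaE[Bz z2 zz]; split=> // i; rewrite /p /cross_components zz mxE.
  move=> /= [Bz z2 zz]; apply/GammaE; split=> //.
  by apply/matrixP => i j; rewrite ord1 [RHS]mxE; exact: zz.
apply/seteqP; split=> -[[x xi] [y eta]].
  move=> [/GammaE /= [Bx xi0 xxi] [t]].
  have x0 : x != 0 by apply: contra_notN B0 => /eqP <-; case/shell_min1: Bx.
  have xiE := cross_eq0_colinear x0 xxi.
  move=> /exp_flow_cross_preserves/(_ xiE) /= [yx etaE].
  (* A rotation taking x to y also takes ξ = cx to cy, the endpoint found for the flow. *)
  have [M MSO Mx] := SO3_transitive (esym yx).
  by exists x, xi, M; split=> //; rewrite Mx etaE -Mx scalemxAr -xiE.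
move=> [x' [xi' [M [Bx xi0 xxi MSO [-> -> -> ->]]]]].
split; first exact/GammaE.
have x0 : x' != 0 by apply: contra_notN B0 => /eqP <-; case/shell_min1: Bx.
(* The axis of [M] need not be orthogonal to x; a rotation about an orthogonal axis with the same
   effect on x replaces it. *)
have [n [a [n1 nx OxE]]] := cross_rotation x0 (esym (SO3_dot _ _ MSO)).
rewrite (cross_eq0_colinear x0 xxi) /= -scalemxAr OxE.
apply: exp_flow_cross_rotation => // u ux.
by apply: (shell_dot (esym ux)); case/shell_min1: Bx.
Qed.
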